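(* Let $n\geqslant 2$ and $d\geqslant 1$. Take the basis $\{E_{ij}\ (1\leqslant i\neq j\leqslant n),\ E_{ss}-E_{s+1,s+1}\ (1\leqslant s\leqslant n-1)\}$ of $\mathfrak{sl}_n(\mathbb{C})$, assigning variable $x_{ij}$ to $E_{ij}$ ($i\neq j$) and $x_{ss}$ to $E_{ss}-E_{s+1,s+1}$, and let $X=\sum_{s=1}^{n-1}x_{ss}(E_{ss}-E_{s+1,s+1})+\sum_{i\neq j}x_{ij}E_{ij}$ be the generic matrix, so its diagonal is $(x_{11},\,x_{22}-x_{11},\,\dots,\,x_{n-1,n-1}-x_{n-2,n-2},\,-x_{n-1,n-1})$. Let $\mathrm{tr}_i=\mathrm{Tr}(X^i)$. Then the coefficient algebra $B_{\mathfrak{sl}_n(\mathbb{C})}(S^d(\mathbb{C}^n))$ with respect to this basis equals $\mathbb{C}[\mathrm{tr}_2,\mathrm{tr}_3,\dots,\mathrm{tr}_n]$, which is a polynomial algebra and coincides with the invariant ring $\mathbb{C}[\mathfrak{sl}_n(\mathbb{C})]^{\mathrm{SL}_n(\mathbb{C})}$ of the conjugation action of $\mathrm{SL}_n(\mathbb{C})$ on $\mathfrak{sl}_n(\mathbb{C})$ (in the coordinates $x_{ij},x_{ss}$).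
   Context: Let $\mathfrak{g}$ be a finite-dimensional Lie algebra over a field $k$ with a fixed basis $\{g_1,\dots,g_N\}$, and $V$ an $m$-dimensional representation; write $[g]$ for the matrix of $g$ acting on $V$. The characteristic polynomial of $\mathfrak g$ on $V$ is $\varphi_{\mathfrak g}(V)=\det(x_0 I+\sum_l y_l[g_l])$ with $x_0$ and one variable $y_l$ per basis element indeterminates; writing $\varphi_{\mathfrak g}(V)=x_0^m+c_1x_0^{m-1}+\cdots+c_m$, the coefficient algebra $B_{\mathfrak g}(V)$ is the $k$-subalgebra generated by $c_1,\dots,c_m$. $E_{ij}$ denotes the matrix unit. $\mathbb{C}^n$ is the standard representation with basis $e_1,\dots,e_n$, and $S^d(\mathbb{C}^n)$ its $d$-th symmetric power with action $g\cdot(e_{i_1}\cdots e_{i_d})=\sum_{s=1}^d e_{i_1}\cdots g(e_{i_s})\cdots e_{i_d}$. *)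

(* Defs.v *)
From HB Require Import structures.
From mathcomp Require Import all_boot all_order all_algebra.
From mathcomp Require Import mpoly.
Set Implicit Arguments. Unset Strict Implicit. Unset Printing Implicit Defensive.
Import Order.TTheory GRing.Theory Num.Theory.
Local Open Scope ring_scope.

Section Defs.
Variable C : numClosedFieldType.

Definition in_gen_alg (k : nat) (s : seq {mpoly C[k]}) (f : {mpoly C[k]}) : Prop :=
  exists q : {mpoly C[size s]}, f = q \mPo (in_tuple s).

Definition alg_indep (k : nat) (s : seq {mpoly C[k]}) : Prop :=
  forall q : {mpoly C[size s]}, q \mPo (in_tuple s) = 0 -> q = 0.

Variable n : nat.
(* number of basis elements / variables : dim sl_n = n^2 - 1.
   Index k < n*n-1 encodes the pair (i,j) = (k %/ n, k %% n) (0-based);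
   the excluded index n*n-1 is the pair (n-1,n-1).
   For i <> j the basis element is E_ij (variable x_ij);
   for i = j = s (necessarily s <= n-2) it is E_ss - E_{s+1,s+1} (variable x_ss). *)
Definition N := (n * n).-1.

Definition sl_basis (k : 'I_N) : 'M[C]_n :=
  let i := (k %/ n)%N in let j := (k %% n)%N in
  \matrix_(a < n, b < n)
    if i != j then (((a == i :> nat) && (b == j :> nat)) %:R : C)
    else ((((a == b) && (a == i :> nat)) %:R : C)
          - (((a == b) && (a == i.+1 :> nat)) %:R : C)).

Definition sl_point (a : 'I_N -> C) : 'M[C]_n := \sum_(k < N) a k *: sl_basis k.

Definition generic_mx : 'M[{mpoly C[N]}]_n :=
  \matrix_(a < n, b < n) \sum_(k < N) 'X_k * (sl_basis k a b)%:MP.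

Definition traces : seq {mpoly C[N]} :=
  [seq \tr (generic_mx ^+ i) | i <- iota 2 n.-1].

Variable d : nat.
(* S^d(C^n) is realized inside {mpoly C[n]} (e_i <-> 'X_i); its basis is the
   set of monomials e_{i_1} ... e_{i_d}, indexed by nondecreasing d-tuples *)
Definition sym_index := {t : d.-tuple 'I_n | sorted (fun a b : 'I_n => (a <= b)%N) t}.

Definition mnm_of (t : d.-tuple 'I_n) : 'X_{1..n} :=
  [multinom (count_mem i t) | i < n].

Definition sym_act (A : 'M[C]_n) (t : d.-tuple 'I_n) : {mpoly C[n]} :=
  \sum_(s < d) \prod_(r < d)
     (if r == s then \sum_(i < n) A i (tnth t r) *: 'X_i else 'X_(tnth t r)).

Definition sym_dim := #|{: sym_index}|.

Definition sym_mx (A : 'M[C]_n) : 'M[C]_sym_dim :=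
  \matrix_(i < sym_dim, j < sym_dim)
    (sym_act A (val (enum_val j)))@_(mnm_of (val (enum_val i))).

Definition char_poly_sym : {poly {mpoly C[N]}} :=
  \det (\matrix_(i < sym_dim, j < sym_dim)
          ((i == j)%:R *: 'X
           + (\sum_(k < N) 'X_k * (sym_mx (sl_basis k) i j)%:MP)%:P)).

Definition char_coeffs : seq {mpoly C[N]} :=
  [seq char_poly_sym`_(sym_dim - i) | i <- iota 1 sym_dim].

End Defs.

Definition sl_invariant (C : numClosedFieldType) (n : nat) (f : {mpoly C[N n]}) : Prop :=
  forall g : 'M[C]_n, \det g = 1 ->
  forall a b : 'I_(N n) -> C,
    sl_point b = g *m sl_point a *m invmx g -> f.@[b] = f.@[a].

(* Main.v *)
(** Conjugating a triangular matrix by [diag (t^i)] and letting [t] go to [0]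
    shows that an invariant polynomial takes the same value at a matrix and at
    the diagonal matrix of its eigenvalues, so identities between invariants
    need only be checked on traceless diagonal matrices [diag l].

    There an invariant restricts to a symmetric polynomial, which Newton's
    identities rewrite through the power sums [tr X^k]; the first one vanishes.
    The traces are algebraically independent because, over an algebraically
    closed field, [p_2, ..., p_n] take arbitrary values on [p_1 = 0].

    The eigenvalues of [S^d X] are the weights [m . l] with [|m| = d]. Writing
    [T_{d,k}] for the power sum of the [(m . l)^k], the analogue of
    [d h_d = \sum_r p_r h_{d-r}] is
    [d T_{d,k} = \sum_{1 <= r <= d} \sum_{j <= k} 'C(k, j) r^j p_j T_{d-r,k-j}],
    whence [T_{d,k} = c p_k] plus a polynomial in [p_1, ..., p_{k-1}] with [c > 0].
    So [tr X^k] can be recovered from the coefficients of the characteristic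
    polynomial of [S^d X]. *)

Require Import Defs.
From HB Require Import structures.
From mathcomp Require Import all_boot all_order all_algebra perm.
From mathcomp Require Import mpoly.
Set Implicit Arguments. Unset Strict Implicit. Unset Printing Implicit Defensive.
Import Order.TTheory GRing.Theory Num.Theory.
Local Open Scope ring_scope.

(** * Polynomials as functions, and generated subalgebras *)

(** In characteristic zero the numerals below [size p] are distinct, and they are too many roots for
    a nonzero [p]. *)
Lemma poly_vanish (R : numDomainType) (p : {poly R}) :
  (forall t, p.[t] = 0) -> p = 0.
Proof.
move=> p0; apply/eqP/negPn/negP => pn0.
suff: (size [seq i%:R : R | i <- iota 0 (size p)] < size p)%N.
  by rewrite size_map size_iota ltnn.
apply: max_poly_roots => //; first by apply/allP => x _; rewrite /root p0.
rewrite map_inj_uniq ?iota_uniq // => i j /eqP.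
by rewrite eqr_nat => /eqP.
Qed.

(** Uniqueness of base [B] expansions: reduction modulo [B] isolates the lowest digit, division by
    [B] leaves the others. *)
Lemma digits_inj n B (a b : 'I_n -> nat) :
  (forall i, a i < B)%N -> (forall i, b i < B)%N ->
  (\sum_(i < n) a i * B ^ i = \sum_(i < n) b i * B ^ i)%N -> a =1 b.
Proof.
elim: n a b => [|n IH] a b aB bB; first by move=> _ [].
have B0 : (0 < B)%N by apply: leq_ltn_trans (aB ord0).
rewrite !big_ord_recl !muln1.
have shift (c : 'I_n.+1 -> nat) : (\sum_(i < n) c (lift ord0 i) * B ^ (lift ord0 i)
    = (\sum_(i < n) c (lift ord0 i) * B ^ i) * B)%N.
  rewrite big_distrl /=; apply: eq_bigr => i _.
  by rewrite /bump /= add1n expnSr mulnA.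
rewrite !shift !(addnC (_ ord0)) => eqab.
have h0 : a ord0 = b ord0.
  by have := congr1 (modn^~ B) eqab; rewrite /= !modnMDl !modn_small.
have hS : (fun i => a (lift ord0 i)) =1 (fun i => b (lift ord0 i)).
  apply: IH => [i|i|]; [exact: aB|exact: bB|].
  have := congr1 (divn^~ B) eqab.
  by rewrite /= !divnMDl // h0 => /eqP; rewrite eqn_add2r => /eqP.
by move=> i; case: (unliftP ord0 i) => [j ->|->].
Qed.

Lemma horner_mmap (R : comNzRingType) n (h : 'I_n -> {poly R}) (f : {mpoly R[n]}) t :
  (mmap polyC h f).[t] = f.@[fun i => (h i).[t]].
Proof.
rewrite /mmap mevalE horner_sum; apply: eq_bigr => m _.
rewrite hornerM hornerC; congr (_ * _).
rewrite /mmap1 horner_prod; apply: eq_bigr => i _.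
by rewrite horner_exp.
Qed.

(** Reduces identities between multivariate polynomials to a comparison of values. *)
Lemma mpoly_vanish (R : numDomainType) n (f : {mpoly R[n]}) :
  (forall v, f.@[v] = 0) -> f = 0.
Proof.
move=> f0; set B := msize f.
(* Kronecker substitution: degrees below [B] make the monomials distinct powers. *)
pose w (m : 'X_{1..n}) := (\sum_(i < n) m i * B ^ i)%N.
pose p : {poly R} := mmap polyC (fun i => 'X^(B ^ i)) f.
have p0 : p = 0 by apply: poly_vanish => t; rewrite horner_mmap f0.
have pE : p = \sum_(m <- msupp f) f@_m *: 'X^(w m).
  apply: eq_bigr => m _; rewrite -mul_polyC; congr (_ * _).
  rewrite (big_morph _ (exprD 'X) (expr0 'X)) /mmap1.
  by apply: eq_bigr => i _; rewrite -exprM mulnC.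
have digit m : m \in msupp f -> forall i : 'I_n, (m i < B)%N.
  move=> mf i; apply: leq_ltn_trans (msize_mdeg_lt mf).
  by rewrite mdegE (bigD1 i) //= leq_addr.
apply/mpolyP => m; rewrite mcoeff0; case: (boolP (m \in msupp f)) => [mf|/memN_msupp_eq0 //].
have := congr1 (fun q : {poly R} => q`_(w m)) p0; rewrite pE coef0 coef_sum.
rewrite (bigD1_seq m) ?msupp_uniq //= coefZ coefXn eqxx mulr1 big_seq_cond big1 ?addr0 //.
move=> m' /andP[m'f m'm]; rewrite coefZ coefXn; case: eqP => [/esym ew|]; last by rewrite mulr0.
case/eqP: m'm; apply/mnmP; apply: digits_inj ew; exact: digit.
Qed.

Section GeneratedAlgebra.
Variables (C : numClosedFieldType) (k : nat).
Implicit Types (s : seq {mpoly C[k]}) (f g : {mpoly C[k]}).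

Lemma gen_algC s c : in_gen_alg s c%:MP.
Proof. by exists c%:MP; rewrite comp_mpolyC. Qed.

Lemma gen_algD s f g : in_gen_alg s f -> in_gen_alg s g -> in_gen_alg s (f + g).
Proof. by move=> [p ->] [q ->]; exists (p + q); rewrite comp_mpolyD. Qed.

Lemma gen_algM s f g : in_gen_alg s f -> in_gen_alg s g -> in_gen_alg s (f * g).
Proof. by move=> [p ->] [q ->]; exists (p * q); rewrite rmorphM. Qed.

Lemma gen_alg0 s : in_gen_alg s 0.
Proof. by rewrite -mpolyC0; apply: gen_algC. Qed.

Lemma gen_alg1 s : in_gen_alg s 1.
Proof. by rewrite -mpolyC1; apply: gen_algC. Qed.

Lemma gen_algZ s c f : in_gen_alg s f -> in_gen_alg s (c *: f).
Proof. by rewrite -mul_mpolyC; apply: gen_algM; apply: gen_algC. Qed.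

Lemma gen_algB s f g : in_gen_alg s f -> in_gen_alg s g -> in_gen_alg s (f - g).
Proof. by move=> sf sg; rewrite -scaleN1r; apply/gen_algD/gen_algZ. Qed.

Lemma gen_alg_nat s j : in_gen_alg s j%:R.
Proof. by rewrite -mpolyC_nat; apply: gen_algC. Qed.

Lemma gen_alg_mem s f : f \in s -> in_gen_alg s f.
Proof.
move=> fs; have ltf : (index f s < size s)%N by rewrite index_mem.
by exists 'X_(Ordinal ltf); rewrite comp_mpolyXU /= nth_index.
Qed.

Lemma gen_alg_sum s I (r : seq I) (P : pred I) (F : I -> {mpoly C[k]}) :
  (forall i, P i -> in_gen_alg s (F i)) -> in_gen_alg s (\sum_(i <- r | P i) F i).
Proof.
by move=> sF; apply: big_ind => //; [exact: gen_alg0 | exact: gen_algD].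
Qed.

Lemma gen_algX s f j : in_gen_alg s f -> in_gen_alg s (f ^+ j).
Proof.
by move=> sf; elim: j => [|j IH]; [exact: gen_alg1 | rewrite exprS; exact: gen_algM].
Qed.

Lemma gen_alg_sign s j : in_gen_alg s ((-1) ^+ j).
Proof.
by apply: gen_algX; rewrite -[-1]sub0r; apply: gen_algB; [exact: gen_alg0 | exact: gen_alg1].
Qed.

Lemma gen_alg_prod s I (r : seq I) (P : pred I) (F : I -> {mpoly C[k]}) :
  (forall i, P i -> in_gen_alg s (F i)) -> in_gen_alg s (\prod_(i <- r | P i) F i).
Proof.
by move=> sF; apply: big_ind => //; [exact: gen_alg1 | exact: gen_algM].
Qed.

Lemma gen_alg_comp s j (t : j.-tuple {mpoly C[k]}) (q : {mpoly C[j]}) :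
  (forall i, in_gen_alg s (tnth t i)) -> in_gen_alg s (q \mPo t).
Proof.
move=> st; rewrite comp_mpolyE; apply: gen_alg_sum => m _.
by apply/gen_algZ/gen_alg_prod => i _; apply: gen_algX.
Qed.

(** Inclusions between generated algebras are checked on generators. *)
Lemma gen_alg_trans s s' f :
  (forall g, g \in s -> in_gen_alg s' g) -> in_gen_alg s f -> in_gen_alg s' f.
Proof. by move=> ss' [q ->]; apply: gen_alg_comp => i; apply/ss'/mem_tnth. Qed.

End GeneratedAlgebra.

(** * Newton's identities *)

(** Stated for an abstract map [D] so as to serve both the formal derivative, in Newton's
    identities, and [sym_der], in the comparison with [sym_act]. *)
Lemma derivation_prod (R : comNzRingType) (D : R -> R) (I : finType) (F : I -> R) :
  (forall f g, D (f * g) = D f * g + f * D g) ->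
  D (\prod_i F i) = \sum_s \prod_i (if i == s then D (F i) else F i).
Proof.
move=> DM; have D1 : D 1 = 0.
  by apply: (addIr (D 1)); rewrite add0r -[in RHS](mulr1 1) DM mulr1 mul1r.
have: uniq (index_enum I) by exact: index_enum_uniq.
elim: (index_enum I) => [|a r IH] /=; first by rewrite !big_nil.
move=> /andP[ar ur]; rewrite big_cons DM IH // big_cons big_cons eqxx mulr_sumr.
congr (_ * _ + _).
  by apply: eq_big_seq => i ir; case: eqP => // ia; rewrite -ia ir in ar.
apply: eq_big_seq => s sr; rewrite big_cons; case: eqP => // sa.
by rewrite sa sr in ar.
Qed.

Section Newton.
Variables (R : comNzRingType) (I : finType) (x : I -> R).

(** Elementary symmetric functions. The family has an arbitrary finite index type because it will be
    either the eigenvalues of a diagonal matrix or the weights of a symmetric power. *)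
Definition esum k := \sum_(A : {set I} | #|A| == k) \prod_(i in A) x i.
Definition psum k := \sum_i x i ^+ k.

Lemma coef_prod_1ZX k : (\prod_i (1 + x i *: 'X))`_k = esum k.
Proof.
rewrite (eq_bigr (fun i => x i *: 'X + 1)) => [|i _]; last by rewrite addrC.
rewrite bigA_distr coef_sum /esum [RHS]big_mkcond; apply: eq_bigr => A _.
rewrite -big_mkcond /= (eq_bigr (fun i => (x i)%:P * 'X)) => [|i _]; last first.
  by rewrite mul_polyC.
rewrite big_split /= prodr_const -rmorph_prod /= coefCM coefXn eq_sym.
by case: eqP; rewrite ?mulr1 ?mulr0.
Qed.

(** In the expansion of the product, taking ['X] on a set leaves the constants on its complement;
    hence the reindexing by complements. *)
Lemma coef_prod_XDC k : (k <= #|I|)%N ->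
  (\prod_i ('X + (x i)%:P))`_(#|I| - k) = esum k.
Proof.
move=> kI; rewrite bigA_distr coef_sum.
rewrite (reindex_inj (inv_inj (@setCK I))) /= /esum [RHS]big_mkcond.
apply: eq_bigr => A _; rewrite (bigID (mem A)) /=.
rewrite (eq_bigr (fun i => (x i)%:P)) => [|i iA]; last by rewrite inE iA.
rewrite [X in _ * X](eq_bigr (fun i => 'X)) => [|i iA]; last by rewrite inE iA.
rewrite prodr_const -rmorph_prod /= coefCM coefXn.
have -> : #|[pred i | i \notin A]| = (#|I| - #|A|)%N.
  by rewrite -(cardC (mem A)) addKn.
have AI := max_card (mem A).
have -> : (#|I| - k == #|I| - #|A|)%N = (#|A| == k).
  by apply/eqP/eqP => [e|->//]; rewrite -(subKn AI) -e subKn.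
by case: eqP; rewrite ?mulr1 ?mulr0.
Qed.

Lemma esum0 : esum 0 = 1.
Proof.
rewrite /esum (big_pred1 set0) ?big_set0 // => A.
by rewrite cards_eq0.
Qed.

Lemma esum_gt k : (#|I| < k)%N -> esum k = 0.
Proof.
move=> Ik; rewrite /esum big_pred0 // => A.
by apply/negbTE; rewrite neq_ltn (leq_ltn_trans (max_card _) Ik).
Qed.


(** Compare coefficients in [E' = \sum_s x_s E / (1 + x_s X)] for [E = \prod_i (1 + x_i X)]. *)
Lemma newton k :
  k.+1%:R * esum k.+1 = \sum_(j < k.+1) (-1) ^+ j * psum j.+1 * esum (k - j)%N.
Proof.
pose E : {poly R} := \prod_i (1 + x i *: 'X).
pose E_ s : {poly R} := \prod_(i | i != s) (1 + x i *: 'X).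
have EE s : E = (1 + x s *: 'X) * E_ s by rewrite /E (bigD1 s).
(* Division of [E] by [1 + x_s X], as a geometric series. *)
have coefE s m : (E_ s)`_m = \sum_(j < m.+1) (- x s) ^+ j * esum (m - j)%N.
  elim: m => [|m IH].
    have := coef_prod_1ZX 0; rewrite -/E (EE s) big_ord1 mul1r sub0n => <-.
    by rewrite mulrDl mul1r coefD -scalerAl coefZ coefXM mulr0 addr0.
  rewrite big_ord_recl mul1r subn0 -(coef_prod_1ZX m.+1) -/E (EE s).
  rewrite mulrDl mul1r coefD -scalerAl coefZ coefXM /= IH.
  rewrite [X in _ + X](eq_bigr (fun j : 'I_m.+1 => - x s * ((- x s) ^+ j * esum (m - j)%N))).
    by rewrite -mulr_sumr mulNr addrK.
  by move=> j _; rewrite mulrA -exprS subSS.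
have dE : E^`() = \sum_s x s *: E_ s.
  rewrite (derivation_prod _ (@derivM R)); apply: eq_bigr => s _.
  rewrite (bigD1 s) //= eqxx derivD derivC add0r derivZ derivX -scalerAl mul1r.
  by congr (_ *: _); apply: eq_bigr => i /negbTE ->.
have := congr1 (fun p : {poly R} => p`_k) dE.
rewrite coef_deriv coef_prod_1ZX coef_sum mulr_natl => ->.
under eq_bigr => s _ do rewrite coefZ coefE mulr_sumr.
rewrite exchange_big /=; apply: eq_bigr => j _.
rewrite [_ * psum _]mulr_sumr mulr_suml; apply: eq_bigr => s _.
by rewrite mulrA [(- x s) ^+ j]exprNn exprS mulrCA.
Qed.

End Newton.

(** * Newton's recursion determines either sequence from the other *)

Section NewtonRecursion.
Variable R : numDomainType.
Implicit Types e t : nat -> R.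

Lemma newton_esum_uniq e e' t : e 0%N = e' 0%N ->
  (forall k, k.+1%:R * e k.+1 = \sum_(j < k.+1) (-1) ^+ j * t j.+1 * e (k - j)%N) ->
  (forall k, k.+1%:R * e' k.+1 = \sum_(j < k.+1) (-1) ^+ j * t j.+1 * e' (k - j)%N) ->
  e =1 e'.
Proof.
move=> e0 eE e'E; elim/ltn_ind => -[//|k IH].
apply: (@mulfI _ k.+1%:R); first by rewrite pnatr_eq0.
rewrite eE e'E; apply: eq_bigr => j _; rewrite IH // ltnS leq_subr //.
Qed.

(** As [e 0 = 1], the last summand isolates [t k.+1] up to sign. The range stops at [n] because in
    the application [e] is known to be an elementary symmetric function only that far. *)
Lemma newton_psum_uniq n e t t' : e 0%N = 1 ->
  (forall k, (k < n)%N ->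
     k.+1%:R * e k.+1 = \sum_(j < k.+1) (-1) ^+ j * t j.+1 * e (k - j)%N) ->
  (forall k, (k < n)%N ->
     k.+1%:R * e k.+1 = \sum_(j < k.+1) (-1) ^+ j * t' j.+1 * e (k - j)%N) ->
  forall k, (k < n)%N -> t k.+1 = t' k.+1.
Proof.
move=> e0 eE e'E; elim/ltn_ind => k IH kn.
have := eE k kn; rewrite e'E // !big_ord_recr /= subnn e0 !mulr1.
have -> : \sum_(i < k) (-1) ^+ i * t' i.+1 * e (k - i)%N
        = \sum_(i < k) (-1) ^+ i * t i.+1 * e (k - i)%N.
  by apply: eq_bigr => j _; rewrite IH // (ltn_trans _ kn).
by move/addrI/(mulfI _) => -> //; rewrite signr_eq0.
Qed.

End NewtonRecursion.

(** * Newton's recursion inside generated algebras *)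

Section NewtonMpoly.
Variables (C : numClosedFieldType) (m : nat).
Implicit Types (e t : nat -> {mpoly C[m]}).

(** The list holds the values for [k, k - 1, ..., 0] in this order, so that a structural recursion
    has all earlier values at hand: entry [j] has index [k - j]. *)
Fixpoint newton_seq t k : seq {mpoly C[m]} :=
  if k is k'.+1 then
    (k%:R^-1 *: \sum_(j < k) (-1) ^+ j * t j.+1 * (newton_seq t k')`_j)
      :: newton_seq t k'
  else [:: 1].

Definition esum_of_psum t k := head 0 (newton_seq t k).

Lemma esum_of_psum0 t : esum_of_psum t 0 = 1. Proof. by []. Qed.

Lemma esum_of_psumS t k : k.+1%:R * esum_of_psum t k.+1 =
  \sum_(j < k.+1) (-1) ^+ j * t j.+1 * esum_of_psum t (k - j)%N.
Proof.
have nthE : forall k j, (j <= k)%N -> (newton_seq t k)`_j = esum_of_psum t (k - j)%N.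
  by elim=> [|k' IH] [|j] //= jk; rewrite IH.
rewrite /esum_of_psum /= -mpolyC_nat mul_mpolyC scalerA mulfV ?pnatr_eq0 // scale1r.
by apply: eq_bigr => j _; rewrite nthE // -ltnS.
Qed.

Lemma meval_esum_of_psumS t (a : 'I_m -> C) k : k.+1%:R * (esum_of_psum t k.+1).@[a] =
  \sum_(j < k.+1) (-1) ^+ j * (t j.+1).@[a] * (esum_of_psum t (k - j)%N).@[a].
Proof.
have := congr1 (meval a) (esum_of_psumS t k); rewrite mevalM rmorph_nat => ->.
by rewrite raddf_sum; apply: eq_bigr => j _; rewrite /= !mevalM rmorph_sign.
Qed.

(** Only [t 1, ..., t n] enter the values up to [e n], which matches the finitely many traces
    available as generators. *)
Lemma gen_alg_esum s e t : e 0%N = 1 ->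
  (forall k, k.+1%:R * e k.+1 = \sum_(j < k.+1) (-1) ^+ j * t j.+1 * e (k - j)%N) ->
  forall n, (forall k, (k < n)%N -> in_gen_alg s (t k.+1)) ->
  forall k, (k <= n)%N -> in_gen_alg s (e k).
Proof.
move=> e0 eE n st; elim/ltn_ind => -[|k] IH kn; first by rewrite e0; exact: gen_alg1.
have -> : e k.+1 = k.+1%:R^-1 *: (k.+1%:R * e k.+1).
  by rewrite -mpolyC_nat mul_mpolyC scalerA mulVf ?pnatr_eq0 // scale1r.
rewrite eE; apply/gen_algZ/gen_alg_sum => j _; apply/gen_algM/IH; first last.
- by rewrite (leq_trans (leq_subr _ _)) // ltnW.
- by rewrite ltnS leq_subr.
by apply/gen_algM/st; [exact: gen_alg_sign | exact: leq_trans kn].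
Qed.

(** Since [e 0 = 1], solving the recursion for its last summand costs only a sign. *)
Lemma gen_alg_psum s e t : e 0%N = 1 ->
  (forall k, k.+1%:R * e k.+1 = \sum_(j < k.+1) (-1) ^+ j * t j.+1 * e (k - j)%N) ->
  (forall k, in_gen_alg s (e k)) -> forall k, in_gen_alg s (t k.+1).
Proof.
move=> e0 eE se; elim/ltn_ind => k IH.
have := eE k; rewrite big_ord_recr /= subnn e0 mulr1 addrC => /eqP.
rewrite -subr_eq => /eqP/(congr1 (fun f => (-1) ^+ k * f)).
rewrite signrMK => <-; apply: gen_algM; first exact: gen_alg_sign.
apply: gen_algB; first by apply/gen_algM/se/gen_alg_nat.
apply: gen_alg_sum => j _; apply/gen_algM/se/gen_algM; [exact: gen_alg_sign | exact: IH].
Qed.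

End NewtonMpoly.

(** * Invariants are determined on diagonal matrices *)

(** Decodes the numbering of pairs used by [sl_basis]. *)
Lemma sum_divn_modn (V : nmodType) m n (F : nat -> nat -> V) :
  \sum_(k < m * n) F (k %/ n)%N (k %% n)%N = \sum_(i < m) \sum_(j < n) F i j.
Proof.
elim: m => [|m IH]; first by rewrite mul0n !big_ord0.
rewrite big_ord_recr /= -IH -!(big_mkord xpredT (fun k => F (k %/ n)%N (k %% n)%N)) mulSnr.
rewrite (big_cat_nat (leq0n _) (leq_addr n _)) /=; congr (_ + _).
rewrite -{1}[(m * n)%N]add0n big_addn addKn big_mkord; apply: eq_bigr => j _.
have n0 : (0 < n)%N by apply: leq_ltn_trans (ltn_ord j).
by rewrite addnC divnMDl // modnMDl divn_small // modn_small // addn0.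
Qed.

(** * Coordinates of a traceless matrix in the basis [sl_basis] *)

Section Coordinates.
Variables (R : nzRingType) (n : nat).
Implicit Type A : 'M[R]_n.

(** Decoding an index yields natural numbers; summing over matching ordinals gives the matrix entry
    without carrying bounds. *)
Definition entry A (i j : nat) : R :=
  \sum_(a < n | a == i :> nat) \sum_(b < n | b == j :> nat) A a b.

(* The coefficient of [E_ss - E_{s+1,s+1}] in a traceless matrix is the partial
   sum [A_00 + ... + A_ss] of its diagonal. *)
Definition coord A (i j : nat) : R :=
  if i != j then entry A i j else \sum_(l < n | (l <= i)%N) A l l.

Definition coords A (k : 'I_(N n)) : R := coord A (k %/ n) (k %% n).

Lemma entryE A (a b : 'I_n) : entry A a b = A a b.
Proof. by rewrite /entry (big_pred1 a) // (big_pred1 b). Qed.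

End Coordinates.

(** Allows coordinates to be taken over a polynomial ring and specialised afterwards. *)
Lemma map_coords (R S : nzRingType) n (f : {rmorphism R -> S}) (A : 'M[R]_n) k :
  f (coords A k) = coords (map_mx f A) k.
Proof.
rewrite /coords /coord; case: ifP => _; rewrite rmorph_sum; apply: eq_bigr => a _.
  by rewrite rmorph_sum; apply: eq_bigr => b _; rewrite mxE.
by rewrite mxE.
Qed.

Section SlPoint.
Variables (C : numClosedFieldType) (n : nat).
Hypothesis n_gt0 : (0 < n)%N.
Implicit Type A : 'M[C]_n.

Lemma coordsK A : \tr A = 0 -> sl_point (coords A) = A.
Proof.
move=> trA; apply/matrixP => a b; rewrite /sl_point summxE.
pose F i j : C := coord A i j *
  (if i != j then ((a == i :> nat) && (b == j :> nat))%:R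
   else ((a == b) && (a == i :> nat))%:R - ((a == b) && (a == i.+1 :> nat))%:R).
rewrite (eq_bigr (fun k : 'I_(N n) => F (k %/ n)%N (k %% n)%N)); last first.
  by move=> k _; rewrite !mxE.
(* The coordinate at the excluded pair would be the full trace, which is zero; the sum may therefore
   run over all [n * n] pairs. *)
have lastF : F n.-1 n.-1 = 0.
  rewrite /F /coord eqxx /=; set s := (X in X * _); suff -> : s = 0 by rewrite mul0r.
  by rewrite -trA; apply: eq_bigl => l; rewrite -ltnS prednK // ltn_ord.
have -> : \sum_(k < N n) F (k %/ n)%N (k %% n)%N
        = \sum_(k < (n * n)%N) F (k %/ n)%N (k %% n)%N.
  have NS : (n * n)%N = (N n).+1 by rewrite /N prednK // muln_gt0 n_gt0.
  rewrite NS big_ord_recr /=; suff [-> ->] : (N n %/ n)%N = n.-1 /\ (N n %% n)%N = n.-1.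
    by rewrite lastF addr0.
  have -> : N n = (n.-1 * n + n.-1)%N.
    by apply: succn_inj; rewrite -NS -addnS prednK // -mulSnr prednK.
  by rewrite divnMDl // modnMDl divn_small ?modn_small ?addn0 // prednK.
rewrite sum_divn_modn; have [ab|ab] := eqVneq a b; last first.
  have F0 (i j : 'I_n) : (i != a) || (j != b) -> F i j = 0.
    have ordE (x y : 'I_n) : (x == y :> nat) = (y == x) by rewrite eq_sym.
    rewrite /F (negbTE ab) !(ordE a) !(ordE b) /= => /orP ijab.
    case: ifP => _; last by rewrite subrr mulr0.
    by case: ijab => /negbTE ->; rewrite ?andbF mulr0.
  rewrite (bigD1 a) //= (bigD1 b) //= [X in _ + X]big1 => [|i ia]; last first.
    by rewrite big1 // => j _; rewrite F0 ?ia.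
  rewrite big1 => [|j jb]; last by rewrite F0 ?jb ?orbT.
  by rewrite /F /coord ab !eqxx entryE mulr1 !addr0.
subst b; pose s i := \sum_(l < n | (l <= i)%N) A l l.
(* On the diagonal only the pairs [(i, i)] contribute, and the partial sums telescope. *)
transitivity (\sum_(i < n) s i * ((a == i)%:R - (a == i.+1 :> nat)%:R)).
  apply: eq_bigr => i _; rewrite (bigD1 i) //= [X in _ + X]big1 => [|j ji].
    by rewrite /F /coord !eqxx addr0.
  rewrite eq_sym -(inj_eq val_inj) /= in ji; rewrite /F ji; case: eqP => [->|_].
    by rewrite (negbTE ji) mulr0.
  by rewrite mulr0.
under eq_bigr => i _ do rewrite mulrBr.
rewrite sumrB (bigD1 a) //= eqxx mulr1 big1 ?addr0 => [|i ia]; last first.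
  by rewrite eq_sym (negbTE ia) mulr0.
rewrite {1}/s (bigD1 a) //= -addrA -[RHS]addr0; congr (_ + _); apply/eqP.
rewrite subr_eq0.
(* What remains is [s] at the predecessor of [a], or an empty sum when [a] is the first index. *)
clear F lastF; apply/eqP; case: a => -[|a] an /=.
  rewrite [RHS]big1 => [|i _]; last by rewrite mulr0.
  by rewrite big_pred0 // => l; rewrite leqn0 -(inj_eq val_inj) /= andbN.
have an' := ltnW an; rewrite [RHS](bigD1 (Ordinal an')) //= eqxx mulr1.
rewrite [X in _ = _ + X]big1 => [|i ia]; last first.
  by rewrite eqSS eq_sym -[_ == _]/(_ == Ordinal an') (negbTE ia) mulr0.
rewrite addr0; apply: eq_bigl => l.
by rewrite -(inj_eq val_inj) /= andbC -ltn_neqAle ltnS.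
Qed.

Lemma mxtrace_sl_basis (k : 'I_(N n)) : \tr (sl_basis C k) = 0.
Proof.
have kN : (k.+1 < n * n)%N by rewrite -ltn_predRL ltn_ord.
have ki : (k %/ n < n)%N by rewrite ltn_divLR // ltnW.
have kj : (k %% n < n)%N by rewrite ltn_mod.
rewrite /mxtrace; under eq_bigr => a _ do rewrite mxE eqxx /=.
case: (boolP (_ != _)) => ij.
  rewrite big1 // => a _; case: eqP => //= ->.
  by rewrite (negbTE ij).
(* A diagonal pair with [i.+1 = n] would have the excluded index [n * n - 1]. *)
have ki1 : ((k %/ n).+1 < n)%N.
  rewrite ltn_neqAle ki andbT; apply: contraTneq kN => kn.
  rewrite -leqNgt (divn_eq k n) -(eqP (negPn ij)).
  by rewrite -addnS kn addnC -mulSn kn.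
have sum1 i : (i < n)%N -> \sum_(a < n) (a == i :> nat)%:R = 1 :> C.
  move=> ilt; rewrite (bigD1 (Ordinal ilt)) //= eqxx big1 ?addr0 // => a ai.
  by rewrite -[_ == _]/(a == Ordinal ilt) (negbTE ai).
by rewrite sumrB !sum1 // subrr.
Qed.

Lemma mxtrace_sl_point (a : 'I_(N n) -> C) : \tr (sl_point a) = 0.
Proof.
by rewrite /sl_point raddf_sum big1 // => k _; rewrite /= mxtraceZ mxtrace_sl_basis mulr0.
Qed.

Lemma meval_generic_mx (a : 'I_(N n) -> C) : map_mx (meval a) (generic_mx C n) = sl_point a.
Proof.
apply/matrixP => i j; rewrite !mxE raddf_sum summxE; apply: eq_bigr => k _.
by rewrite /= mevalM mevalXU mevalC !mxE.
Qed.

(** Scaling [g] by an [n]-th root of the inverse of its determinant puts it in SL_n and leaves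
    conjugation by it unchanged. *)
Lemma sl_invariant_unit f : sl_invariant f -> forall (g : 'M[C]_n) (a b : 'I_(N n) -> C),
  g \in unitmx -> sl_point b = g *m sl_point a *m invmx g -> f.@[b] = f.@[a].
Proof.
move=> finv g a b gU ab; pose c := n.-root (\det g)^-1.
have dg0 : \det g != 0 by rewrite -unitfE -unitmxE.
have cn : c ^+ n = (\det g)^-1 by rewrite rootCK.
have c0 : c != 0 by have := expf_eq0 c n; rewrite cn invr_eq0 (negbTE dg0) n_gt0 /= => <-.
apply: (finv (c *: g)); first by rewrite detZ cn mulVf.
rewrite invmxZ ?unitmxZ ?unitfE // -!scalemxAl -scalemxAr scalerA.
by rewrite mulfV // scale1r.
Qed.

(* Conjugating a triangular matrix by [diag (t^i)] scales its off-diagonal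
   entries by positive powers of [t]; the value of [f] is a polynomial in [t]
   that is constant for [t != 0], so it equals its value at [t = 0], where only
   the diagonal is left. *)
Lemma sl_invariant_diag (a : 'I_(N n) -> C) : exists2 l : 'rV[C]_n, \sum_i l 0 i = 0 &
  forall f, sl_invariant f -> f.@[a] = f.@[coords (diag_mx l)].
Proof.
have [P /unitarymx_unit PU] := Schur (sl_point a) n_gt0.
rewrite /similar_to /= conjumx // => /is_trig_mxP; set T := P *m _ *m _ => Ttrig.
have trT : \tr T = 0.
  by rewrite /T mxtrace_mulC mulmxA mulVmx // mul1mx mxtrace_sl_point.
exists (\row_i T i i); first by rewrite -[RHS]trT; apply: eq_bigr => i _; rewrite mxE.
move=> f finv; have fT : f.@[coords T] = f.@[a].
  by apply: sl_invariant_unit PU _ => //; rewrite coordsK.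
clearbody T.
(* The truncated exponent [i - j] is [0] above the diagonal, where the lower triangular [T] vanishes
   anyway. *)
pose Tp : 'M[{poly C}]_n := \matrix_(i, j) (T i j *: 'X^(i - j)).
pose p : {poly C} := mmap polyC (coords Tp) f.
pose Tt t : 'M[C]_n := \matrix_(i, j) (T i j * t ^+ (i - j)).
have pE t : p.[t] = f.@[coords (Tt t)].
  rewrite horner_mmap; apply: meval_eq => k.
  rewrite -[LHS]/(horner_eval t _) map_coords; congr (coords _ _).
  by apply/matrixP => i j; rewrite !mxE /= horner_evalE hornerZ hornerXn.
have trTt t : \tr (Tt t) = 0.
  by rewrite -trT; apply: eq_bigr => i _; rewrite !mxE subnn mulr1.
have pt t : t != 0 -> p.[t] = f.@[coords T].
  move=> t0; pose D : 'M[C]_n := diag_mx (\row_i t ^+ i).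
  have DU : D \in unitmx.
    rewrite unitmxE det_diag unitfE; apply/prodf_neq0 => i _.
    by rewrite mxE expf_neq0.
  rewrite pE; apply: (sl_invariant_unit finv DU); rewrite !coordsK //.
  apply: (canRL (mulmxK DU)); apply/matrixP => i j.
  rewrite /D mul_mx_diag mul_diag_mx !mxE; case: (ltnP i j) => ij.
    by rewrite Ttrig // mul0r mulr0 mul0r.
  by rewrite -mulrA -exprD subnK // mulrC.
(* The value of [p] is known only for [t != 0]; the factor ['X] makes the identity hold at [0]
   too. *)
have q0 : (p - (f.@[coords T])%:P) * 'X = 0.
  apply: poly_vanish => t; rewrite !hornerE.
  by have [->|/pt ->] := eqVneq t 0; rewrite ?mulr0 ?subrr ?mul0r.
have {q0} pC : p = (f.@[coords T])%:P.
  by move/eqP: q0; rewrite mulf_eq0 polyX_eq0 orbF subr_eq0 => /eqP.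
have -> : diag_mx (\row_i T i i) = Tt 0.
  apply/matrixP => i j; rewrite !mxE; have [->|ij] := eqVneq i j.
    by rewrite subnn mulr1.
  have [lij|] := ltnP i j; first by rewrite mulr0n (Ttrig i j) // mul0r.
  rewrite leq_eqVlt => /orP[/eqP ji|ltji]; first by rewrite (val_inj ji) eqxx in ij.
  by rewrite mulr0n expr0n subn_eq0 leqNgt ltji mulr0.
by rewrite -pE pC hornerC fT.
Qed.

Lemma eq_sl_invariant f h : sl_invariant f -> sl_invariant h ->
  (forall l : 'rV[C]_n, \sum_i l 0 i = 0 ->
     f.@[coords (diag_mx l)] = h.@[coords (diag_mx l)]) -> f = h.
Proof.
move=> finv hinv fh; apply/eqP; rewrite -subr_eq0; apply/eqP.
apply: mpoly_vanish => a.
have : sl_invariant (f - h).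
  by move=> g g1 u v uv; rewrite !mevalB (finv g g1 u v) // (hinv g g1 u v).
by case: (sl_invariant_diag a) => l l0 fl /fl ->; rewrite mevalB fh // subrr.
Qed.

Lemma sl_point_diag (l : 'rV[C]_n) : \sum_i l 0 i = 0 ->
  sl_point (coords (diag_mx l)) = diag_mx l.
Proof. by move=> l0; rewrite coordsK // mxtrace_diag. Qed.

End SlPoint.

(** * The traces of powers *)

Lemma map_mx_exp (R S : nzRingType) (f : {rmorphism R -> S}) n (A : 'M[R]_n) k :
  map_mx f (A ^+ k) = map_mx f A ^+ k.
Proof.
elim: k => [|k IH]; first by rewrite !expr0 map_mx1.
by rewrite !exprS -!mulmxE map_mxM IH.
Qed.

Lemma conj_mx_exp (R : comUnitRingType) n (g A : 'M[R]_n) k :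
  g \in unitmx -> (g *m A *m invmx g) ^+ k = g *m A ^+ k *m invmx g.
Proof.
move=> gU; elim: k => [|k IH]; first by rewrite !expr0 mulmx1 mulmxV.
by rewrite !exprS -!mulmxE IH !mulmxA mulmxKV.
Qed.

Lemma diag_mx_exp (R : nzRingType) n (l : 'rV[R]_n) k :
  diag_mx l ^+ k = diag_mx (\row_i l 0 i ^+ k).
Proof.
elim: k => [|k IH].
  by apply/matrixP => i j; rewrite expr0 !mxE expr0.
rewrite exprS -mulmxE IH mulmx_diag; congr diag_mx.
by apply/rowP => i; rewrite !mxE exprS.
Qed.

Lemma meval_mesym (R : comNzRingType) n (x : 'I_n -> R) k :
  (mesym n R k).@[x] = esum x k.
Proof.
rewrite /mesym /esum raddf_sum; apply: eq_bigr => A _ /=.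
by rewrite rmorph_prod; apply: eq_bigr => j _; rewrite /= mevalXU.
Qed.

Section TracePolynomials.
Variables (C : numClosedFieldType) (n : nat).
Hypothesis n_gt0 : (0 < n)%N.

Definition trace_poly k : {mpoly C[N n]} := \tr (generic_mx C n ^+ k).

Lemma meval_trace_poly a k : (trace_poly k).@[a] = \tr (sl_point a ^+ k).
Proof. by rewrite /trace_poly -trace_map_mx map_mx_exp meval_generic_mx. Qed.

Lemma sl_invariant_trace_poly k : sl_invariant (trace_poly k).
Proof.
move=> g g1 a b ab; have gU : g \in unitmx by rewrite unitmxE g1 unitr1.
by rewrite !meval_trace_poly ab conj_mx_exp // mxtrace_mulC mulmxA mulVmx ?mul1mx.
Qed.

Lemma trace_poly_diag (l : 'rV[C]_n) k : \sum_i l 0 i = 0 ->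
  (trace_poly k).@[coords (diag_mx l)] = psum (l 0) k.
Proof.
move=> l0; rewrite meval_trace_poly sl_point_diag // diag_mx_exp mxtrace_diag.
by apply: eq_bigr => i _; rewrite mxE.
Qed.

Lemma trace_poly1 : trace_poly 1 = 0.
Proof. by apply: mpoly_vanish => a; rewrite meval_trace_poly mxtrace_sl_point. Qed.

Lemma gen_alg_trace_poly k : (0 < k <= n)%N -> in_gen_alg (traces C n) (trace_poly k).
Proof.
case: k => [//|[_|k /= kn]]; first by rewrite trace_poly1; apply: gen_alg0.
have lt_k : (k < n.-1)%N by rewrite -ltnS prednK.
by apply/gen_alg_mem/map_f; rewrite mem_iota.
Qed.

Lemma sl_invariant_gen s f : (forall h, h \in s -> sl_invariant h) ->
  in_gen_alg s f -> sl_invariant (f : {mpoly C[N n]}).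
Proof.
move=> sinv [q ->] g g1 a b ab; rewrite !comp_mpoly_meval; apply: meval_eq => i.
by apply: sinv ab => //; exact: mem_tnth.
Qed.

Lemma sl_invariant_traces f : in_gen_alg (traces C n) f -> sl_invariant f.
Proof.
apply: sl_invariant_gen => _ /mapP[k _ ->]; exact: sl_invariant_trace_poly.
Qed.

(** Conjugation by a permutation matrix, whose determinant may be [-1]; hence the appeal to
    [sl_invariant_unit]. *)
Lemma sl_invariant_perm f (s : 'S_n) (l l' : 'rV[C]_n) : sl_invariant f ->
  \sum_i l 0 i = 0 -> (forall i, l' 0 i = l 0 (s i)) ->
  f.@[coords (diag_mx l')] = f.@[coords (diag_mx l)].
Proof.
move=> finv l0 l'l; apply: (sl_invariant_unit n_gt0 finv (unitmx_perm C s)).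
have l'0 : \sum_i l' 0 i = 0.
  by rewrite -[RHS]l0 [RHS](reindex_perm s); apply: eq_bigr.
rewrite !sl_point_diag //; apply: (canRL (mulmxK (unitmx_perm C s))).
apply/matrixP => i j; rewrite mul_mx_diag mul_diag_mx !mxE l'l mulrC.
by case: eqP => [<-|]; rewrite ?mulr0 ?mul0r.
Qed.

(** The restriction of [f] to diagonal matrices is symmetric, hence a polynomial [t] in the
    elementary symmetric functions; substituting their Newton expressions in the traces gives an
    invariant [h] with the same restriction. *)
Lemma sl_invariant_in_traces f : sl_invariant f -> in_gen_alg (traces C n) f.
Proof.
move=> finv; have n0 : n%:R != 0 :> C by rewrite pnatr_eq0 -lt0n.
(* Subtracting the mean projects onto traceless vectors, so that the restriction becomes a
   polynomial [F] in [n] free variables. *)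
pose L (i : 'I_n) : {mpoly C[n]} := 'X_i - n%:R^-1 *: \sum_j 'X_j.
pose F := f \mPo [tuple coords (diag_mx (\row_i L i)) k | k < N n].
pose center (v : 'I_n -> C) : 'rV[C]_n := \row_i (v i - n%:R^-1 * \sum_j v j).
have sum_center v : \sum_i center v 0 i = 0.
  under eq_bigr => i _ do rewrite mxE.
  by rewrite sumrB sumr_const card_ord -[_ * _ *+ n]mulr_natl mulVKf // subrr.
have FE v : F.@[v] = f.@[coords (diag_mx (center v))].
  rewrite comp_mpoly_meval; apply: meval_eq => k; rewrite tnth_mktuple map_coords.
  congr (coords _ _); apply/matrixP => i j; rewrite !mxE /= raddfMn /=.
  congr (_ *+ _); rewrite mevalB mevalXU mevalZ; congr (_ - _ * _).
  by rewrite raddf_sum; apply: eq_bigr => j' _; rewrite /= mevalXU.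
have Fsym : F \is symmetric.
  apply/issymP => s; apply/eqP; rewrite -subr_eq0; apply/eqP; apply: mpoly_vanish => v.
  rewrite mevalB; have -> : (msym s F).@[v] = F.@[v \o s].
    have := comp_mpoly_meval v (msym s F) [tuple 'X_i | i < n].
    rewrite comp_mpoly_id => ->; rewrite -!comp_mpoly_meval msym_mPo.
    rewrite comp_mpoly_meval; apply: meval_eq => i.
    by rewrite !tnth_mktuple mevalXU.
  rewrite !FE; apply/eqP; rewrite subr_eq0; apply/eqP.
  apply: (sl_invariant_perm (s := s) finv (sum_center v)) => i.
  by rewrite !mxE /= [in RHS](reindex_perm s).
have [t [tF _]] := sym_fundamental Fsym.
pose e k := esum_of_psum trace_poly k.
have e_gen k : (k <= n)%N -> in_gen_alg (traces C n) (e k).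
  apply: (gen_alg_esum (esum_of_psum0 _) (esum_of_psumS _)) => j jn.
  by apply: gen_alg_trace_poly.
pose h := t \mPo [tuple e i.+1 | i < n].
have h_gen : in_gen_alg (traces C n) h.
  by apply: gen_alg_comp => i; rewrite tnth_mktuple; apply: e_gen.
suff -> : f = h by [].
apply: (eq_sl_invariant n_gt0 finv); first exact: sl_invariant_traces.
move=> l l0; have -> : f.@[coords (diag_mx l)] = F.@[l 0].
  rewrite FE; congr (f.@[coords (diag_mx _)]); apply/rowP => i.
  by rewrite !mxE l0 mulr0 subr0.
rewrite -tF !comp_mpoly_meval; apply: meval_eq => i; rewrite !tnth_mktuple.
rewrite meval_mesym.
(* Both sequences obey Newton's recursion for the power sums of [l]. *)
apply: (@newton_esum_uniq _ (esum (l 0)) (fun k => (e k).@[coords (diag_mx l)]) (psum (l 0))).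
- by rewrite esum0 meval1.
- exact: newton.
move=> k; rewrite meval_esum_of_psumS; apply: eq_bigr => j _.
by rewrite trace_poly_diag.
Qed.

(** Every [v] is the list of traces of some traceless diagonal matrix, its eigenvalues being the
    roots of the polynomial that Newton's recursion prescribes; so [q] vanishes at every [v]. *)
Lemma alg_indep_traces : alg_indep (traces C n).
Proof.
move=> q q0; apply: mpoly_vanish => v.
have sz : size (traces C n) = n.-1 by rewrite size_map size_iota.
(* The prescribed power sums: [v] starts at index [2], and [t 1 = 0] will force the roots to have
   sum zero. *)
pose t j : C := if j is j'.+2 then oapp v 0 (insub j') else 0.
(* Constant polynomials, since [esum_of_psum] takes polynomial input; evaluation returns to
   scalars. *)
pose tX j : {mpoly C[size (traces C n)]} := (t j)%:MP.
pose e k := (esum_of_psum tX k).@[v].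
have eS k : k.+1%:R * e k.+1 = \sum_(j < k.+1) (-1) ^+ j * t j.+1 * e (k - j)%N.
  by rewrite meval_esum_of_psumS; apply: eq_bigr => j _; rewrite mevalC.
have e0 : e 0%N = 1 by rewrite /e esum_of_psum0 meval1.
pose P : {poly C} := \poly_(i < n.+1) ((-1) ^+ (n - i) * e (n - i)%N).
have Pn : P`_n = 1 by rewrite coef_poly ltnSn subnn e0 mulr1.
have sP : size P = n.+1.
  by apply: size_poly_eq; rewrite subnn e0 mulr1 oner_eq0.
have [r] := closed_field_poly_normal P.
rewrite lead_coefE sP Pn scale1r => Pr.
have sr : size r == n by rewrite -eqSS -sP Pr size_prod_XsubC.
pose x := tnth (Tuple sr).
have ex k : (k <= n)%N -> e k = esum x k.
  move=> kn; have := mroots_coeff (Tuple sr) (Ordinal (kn : (k < n.+1)%N)).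
  rewrite -Pr coef_poly ltnS leq_subr subKn //= => /(mulfI _) -> ; last by rewrite signr_eq0.
  by rewrite meval_mesym.
have xt k : (k < n)%N -> psum x k.+1 = t k.+1.
  apply: (@newton_psum_uniq _ n e) => // j jn.
  rewrite ex // newton; apply: eq_bigr => i _.
  by rewrite ex // (leq_trans (leq_subr _ _)) // ltnW.
pose l : 'rV[C]_n := \row_i x i.
have lx : l 0 =1 x by move=> i; rewrite mxE.
have psum_l k : psum (l 0) k = psum x k by apply: eq_bigr => i _; rewrite lx.
have l0 : \sum_i l 0 i = 0.
  have -> : \sum_i l 0 i = psum (l 0) 1 by apply: eq_bigr => i _; rewrite expr1.
  by rewrite psum_l xt.
have := congr1 (meval (coords (diag_mx l))) q0; rewrite meval0 comp_mpoly_meval => <-.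
apply: meval_eq => i; have lt_i : (i < n.-1)%N by rewrite -sz ltn_ord.
have lt_i1 : (i.+1 < n)%N by rewrite -ltn_predRL.
rewrite (tnth_nth 0) /= (nth_map 0%N) ?size_iota // nth_iota // add2n.
rewrite -/(trace_poly _) trace_poly_diag // psum_l xt // /t.
by rewrite (insubT (fun j => j < _)%N (ltn_ord i)) /=; congr v; apply: val_inj.
Qed.


End TracePolynomials.

(** * Symmetric powers *)

(** Suited to identities between derivations and algebra morphisms, which are settled on the
    variables. *)
Lemma mpoly_ring_ind (R : nzRingType) n (P : {mpoly R[n]} -> Prop) :
  (forall c, P c%:MP) -> (forall i, P 'X_i) ->
  (forall p q, P p -> P q -> P (p + q)) -> (forall p q, P p -> P q -> P (p * q)) ->
  forall p, P p.
Proof.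
move=> PC PX PD PM p; rewrite (mpolyE p); apply: big_ind => //.
  by rewrite -mpolyC0; apply: PC.
move=> m _; rewrite -mul_mpolyC; apply: (PM) => //.
have P1 : P 1 by rewrite -mpolyC1; apply: PC.
rewrite mpolyXE_id; apply: big_ind => [||i _]; [exact: P1 | exact: PM |].
by elim: (m i) => [|k IH]; rewrite ?expr0 // exprS; apply: PM.
Qed.

Section SymmetricPower.
Variables (C : numClosedFieldType) (n : nat).
Implicit Types (A B g : 'M[C]_n) (p q : {mpoly C[n]}) (m : 'X_{1..n}).

Definition lin_form A (j : 'I_n) : {mpoly C[n]} := \sum_(i < n) A i j *: 'X_i.

(** The derivation of the symmetric algebra extending [A], that is, the Lie algebra action;
    [sym_subst] is the algebra endomorphism extending [g], that is, the group action. *)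
Definition sym_der A p : {mpoly C[n]} := \sum_j lin_form A j * p^`M(j).

Definition sym_subst g p : {mpoly C[n]} := p \mPo [tuple lin_form g j | j < n].

Lemma sym_der_is_linear A : linear (sym_der A).
Proof.
move=> c p q; rewrite scaler_sumr -big_split; apply: eq_bigr => j _.
by rewrite /= linearP /= mulrDr scalerAr.
Qed.

HB.instance Definition _ A := GRing.isLinear.Build C {mpoly C[n]} {mpoly C[n]} *:%R
  (sym_der A) (sym_der_is_linear A).

HB.instance Definition _ g := GRing.LRMorphism.copy (sym_subst g)
  (comp_mpoly [tuple lin_form g j | j < n]).

Lemma sym_derM A p q : sym_der A (p * q) = sym_der A p * q + p * sym_der A q.
Proof.
rewrite mulr_suml mulr_sumr -big_split; apply: eq_bigr => j _ /=.
by rewrite mderivM mulrDr !mulrA [p * lin_form _ _]mulrC.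
Qed.

Lemma sym_derX A j : sym_der A 'X_j = lin_form A j.
Proof.
rewrite /sym_der (bigD1 j) //= big1 => [|i ij]; rewrite mderivX mnm1E.
  have -> : (U_(j) - U_(j) = 0)%MM by apply/mnmP => k; rewrite mnmBE subnn mnm0E.
  by rewrite eqxx scale1r addr0 mpolyX0 mulr1.
by rewrite eq_sym (negbTE ij) scale0r mulr0.
Qed.

Lemma sym_derC A c : sym_der A c%:MP = 0.
Proof. by rewrite /sym_der big1 // => j _; rewrite mderivC mulr0. Qed.

Lemma sym_substX g j : sym_subst g 'X_j = lin_form g j.
Proof. by rewrite /sym_subst comp_mpolyXU -tnth_nth tnth_mktuple. Qed.

Lemma sym_substC g c : sym_subst g c%:MP = c%:MP.
Proof. exact: comp_mpolyC. Qed.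

Lemma sym_subst_lin_form g A j : sym_subst g (lin_form A j) = lin_form (g *m A) j.
Proof.
rewrite /lin_form linear_sum /=.
under eq_bigr => i _ do rewrite linearZ /= sym_substX scaler_sumr.
rewrite exchange_big; apply: eq_bigr => k _ /=; rewrite mxE scaler_suml.
by apply: eq_bigr => i _; rewrite scalerA mulrC.
Qed.

Lemma sym_der_lin_form A B j : sym_der A (lin_form B j) = lin_form (A *m B) j.
Proof.
rewrite -sym_subst_lin_form /lin_form !linear_sum; apply: eq_bigr => i _.
by rewrite !linearZ /= sym_derX sym_substX.
Qed.

(** Both sides obey the same twisted Leibniz rule, so they need only agree on the variables. With
    [B] the conjugate of [A] by [g], this is the equivariance of the action. *)
Lemma sym_subst_der g A B p : g *m A = B *m g ->
  sym_subst g (sym_der A p) = sym_der B (sym_subst g p).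
Proof.
move=> gA; elim/mpoly_ring_ind: p => [c|i|p q|p q].
- by rewrite sym_derC sym_substC sym_derC linear0.
- by rewrite sym_derX sym_substX sym_subst_lin_form sym_der_lin_form gA.
- by move=> IHp IHq; rewrite !linearD /= IHp IHq.
by move=> IHp IHq; rewrite rmorphM !sym_derM linearD !rmorphM /= IHp IHq.
Qed.

Lemma sym_substM g h p : sym_subst g (sym_subst h p) = sym_subst (g *m h) p.
Proof.
elim/mpoly_ring_ind: p => [c|i|p q|p q]; first by rewrite !sym_substC.
- by rewrite !sym_substX sym_subst_lin_form.
- by move=> IHp IHq; rewrite !linearD /= IHp IHq.
by move=> IHp IHq; rewrite !rmorphM /= IHp IHq.
Qed.

Lemma sym_subst1 p : sym_subst 1%:M p = p.
Proof.
elim/mpoly_ring_ind: p => [c|i|p q|p q]; first by rewrite !sym_substC.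
- rewrite sym_substX /lin_form (bigD1 i) //= big1 => [|j ji].
    by rewrite mxE eqxx scale1r addr0.
  by rewrite mxE (negbTE ji) scale0r.
- by move=> IHp IHq; rewrite !linearD /= IHp IHq.
by move=> IHp IHq; rewrite !rmorphM /= IHp IHq.
Qed.

Lemma sym_der_diag (l : 'rV[C]_n) m :
  sym_der (diag_mx l) 'X_[m] = (\sum_i l 0 i *+ m i) *: 'X_[m].
Proof.
rewrite scaler_suml; apply: eq_bigr => j _.
have -> : lin_form (diag_mx l) j = l 0 j *: 'X_j.
  rewrite /lin_form (bigD1 j) //= big1 => [|i ij]; first by rewrite mxE eqxx addr0.
  by rewrite mxE (negbTE ij) scale0r.
rewrite mderivX -scalerAl -scalerAr scalerA -mpolyXD mulr_natr.
(* When [m j = 0] the truncated [m - U_(j)] is meaningless, but its coefficient is zero. *)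
have [->|mj] := eqVneq (m j) 0%N; first by rewrite !scale0r.
by rewrite addmC submK // lep1mP.
Qed.

Lemma lin_form_dhomog A j : lin_form A j \is 1.-homog.
Proof. by apply: rpred_sum => i _; apply/dhomogZ; rewrite dhomogX /= mdeg1. Qed.

Lemma prod_dhomog d (F : 'I_d -> {mpoly C[n]}) :
  (forall r, F r \is 1.-homog) -> \prod_r F r \is d.-homog.
Proof.
elim: d F => [|d IH] F F1; first by rewrite big_ord0 dhomog1.
by rewrite big_ord_recl; apply: (dhomogM (d := 1%N) (e := d)) => //; apply: IH.
Qed.

(** * The homogeneous part of degree [d] and the matrices acting on it *)

Section Degree.
Variable d : nat.

Definition sym_mnm (i : 'I_(sym_dim n d)) : 'X_{1..n} := mnm_of (val (enum_val i)).

Lemma mpolyX_mnm_of (t : d.-tuple 'I_n) :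
  'X_[mnm_of t] = \prod_(r < d) 'X_(tnth t r) :> {mpoly C[n]}.
Proof.
rewrite mprodXE; congr 'X_[_]; apply/mnmP => i; rewrite mnmE mnm_sumE.
rewrite -sum1_count big_tuple big_mkcond; apply: eq_bigr => r _.
by rewrite mnm1E /=; case: eqP.
Qed.

Lemma sym_act_der A (t : d.-tuple 'I_n) : sym_act A t = sym_der A 'X_[mnm_of t].
Proof.
rewrite mpolyX_mnm_of (derivation_prod _ (sym_derM A)); apply: eq_bigr => s _.
by apply: eq_bigr => r _; case: eqP => // _; rewrite sym_derX.
Qed.

(** Replaces sorted tuples by exponent vectors of degree [d] in all that follows. *)
Lemma mem_sym_mnm m : (m \in codom sym_mnm) = (mdeg m == d).
Proof.
rewrite basis_cover; apply/idP/mapP => [/codomP[i ->]|[t]].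
  exists (val (enum_val i)) => //; rewrite mem_enum inE sorted_map.
  exact: (valP (enum_val i)).
rewrite mem_enum inE sorted_map => t_sorted ->.
pose ti : sym_index n d := Sub t t_sorted.
by apply/codomP; exists (enum_rank ti); rewrite /sym_mnm enum_rankK SubK.
Qed.

Lemma mdeg_sym_mnm i : mdeg (sym_mnm i) = d.
Proof. by apply/eqP; rewrite -mem_sym_mnm codom_f. Qed.

Lemma sym_mnm_inj : injective sym_mnm.
Proof.
move=> i j ij; apply/enum_val_inj/val_inj; apply: inj_s2m ij; rewrite inE sorted_map.
  exact: (valP (enum_val i)).
exact: (valP (enum_val j)).
Qed.

Lemma sym_subst_dhomog g i : sym_subst g 'X_[sym_mnm i] \is d.-homog.
Proof.
rewrite mpolyX_mnm_of rmorph_prod; apply: prod_dhomog => r.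
by rewrite /= sym_substX lin_form_dhomog.
Qed.

Lemma sym_der_dhomog A i : sym_der A 'X_[sym_mnm i] \is d.-homog.
Proof.
rewrite -sym_act_der; apply: rpred_sum => s _; apply: prod_dhomog => r.
case: ifP => _; first exact: lin_form_dhomog.
by rewrite dhomogX /= mdeg1.
Qed.

Lemma dhomog_sym_mnm p : p \is d.-homog -> p = \sum_k p@_(sym_mnm k) *: 'X_[sym_mnm k].
Proof.
move=> pd; apply/mpolyP => m; rewrite raddf_sum /=.
under eq_bigr => k _ do rewrite mcoeffZ mcoeffX.
have [/codomP[k ->]|mN] := boolP (m \in codom sym_mnm).
  rewrite (bigD1 k) //= eqxx mulr1 big1 ?addr0 // => j jk.
  by rewrite (inj_eq sym_mnm_inj) (negbTE jk) mulr0.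
rewrite big1 => [|k _]; last first.
  by case: eqP => [km|]; [rewrite -km codom_f in mN | rewrite mulr0].
by apply: (dhomog_nemf_coeff pd); rewrite -mem_sym_mnm.
Qed.

Definition op_mx (L : {mpoly C[n]} -> {mpoly C[n]}) : 'M[C]_(sym_dim n d) :=
  \matrix_(i, j) (L 'X_[sym_mnm j])@_(sym_mnm i).

(** [op_mx] keeps only degree [d] coefficients; homogeneity of the images under [L2] ensures that
    nothing is lost in between. *)
Lemma op_mxM (L1 L2 : {linear {mpoly C[n]} -> {mpoly C[n]}}) :
  (forall j, L2 'X_[sym_mnm j] \is d.-homog) -> op_mx (L1 \o L2) = op_mx L1 *m op_mx L2.
Proof.
move=> L2d; apply/matrixP => i j; rewrite !mxE /= {1}(dhomog_sym_mnm (L2d j)).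
rewrite !linear_sum /=; apply: eq_bigr => k _.
by rewrite linearZ /= mcoeffZ !mxE mulrC.
Qed.

Lemma eq_op_mx L1 L2 : L1 =1 L2 -> op_mx L1 = op_mx L2.
Proof. by move=> L12; apply/matrixP => i j; rewrite !mxE L12. Qed.

Lemma sym_mxE A : sym_mx d A = op_mx (sym_der A).
Proof. by apply/matrixP => i j; rewrite !mxE sym_act_der. Qed.

Lemma op_mx_substV g : g \in unitmx -> op_mx (sym_subst g) *m op_mx (sym_subst (invmx g)) = 1%:M.
Proof.
move=> gU; rewrite -op_mxM; last exact: sym_subst_dhomog.
apply/matrixP => i j; rewrite !mxE /= sym_substM mulmxV // sym_subst1 mcoeffX.
by rewrite (inj_eq sym_mnm_inj) eq_sym.
Qed.

(** [S] is the matrix of the group action of [g], which intertwines the two derivations. *)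
Lemma sym_mx_conj g A : g \in unitmx -> exists2 S, S \in unitmx &
  sym_mx d (g *m A *m invmx g) = S *m sym_mx d A *m invmx S.
Proof.
move=> gU; have SV := op_mx_substV gU; have [SU _] := mulmx1_unit SV.
exists (op_mx (sym_subst g)) => //; apply: (canRL (mulmxK SU)).
rewrite !sym_mxE -!op_mxM; [|exact: sym_der_dhomog|exact: sym_subst_dhomog].
by apply: eq_op_mx => p /=; rewrite -(@sym_subst_der _ A) // mulmxKV.
Qed.

Lemma sym_mx_diag (l : 'rV[C]_n) :
  sym_mx d (diag_mx l) = diag_mx (\row_k \sum_i l 0 i *+ sym_mnm k i).
Proof.
apply/matrixP => i j; rewrite sym_mxE !mxE sym_der_diag mcoeffZ mcoeffX.
rewrite (inj_eq sym_mnm_inj) eq_sym mulr_natr; case: eqP => [->|]; last by rewrite !mulr0n.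
by [].
Qed.

Lemma sym_mx_is_linear : linear (@sym_mx C n d).
Proof.
have lin_formP c A B j : lin_form (c *: A + B) j = c *: lin_form A j + lin_form B j.
  rewrite scaler_sumr -big_split; apply: eq_bigr => i _.
  by rewrite !mxE scalerDl scalerA.
move=> c A B; apply/matrixP => i j; rewrite !sym_mxE !mxE -mcoeffZ -mcoeffD.
congr (_@__); rewrite scaler_sumr -big_split; apply: eq_bigr => k _.
by rewrite lin_formP mulrDl scalerAl.
Qed.

HB.instance Definition _ := GRing.isLinear.Build C 'M[C]_n 'M[C]_(sym_dim n d) *:%R
  (@sym_mx C n d) sym_mx_is_linear.

Definition sym_generic_mx : 'M[{mpoly C[N n]}]_(sym_dim n d) :=
  \matrix_(i, j) \sum_(k < N n) 'X_k * (sym_mx d (sl_basis C k) i j)%:MP.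

Lemma meval_sym_generic_mx (a : 'I_(N n) -> C) :
  map_mx (meval a) sym_generic_mx = sym_mx d (sl_point a).
Proof.
apply/matrixP => i j; rewrite /sl_point (linear_sum (sym_mx d)) summxE mxE mxE raddf_sum.
by apply: eq_bigr => k _; rewrite /= mevalM mevalXU mevalC linearZ /= [RHS]mxE.
Qed.

Definition sym_trace_poly k : {mpoly C[N n]} := \tr (sym_generic_mx ^+ k).

Lemma meval_sym_trace_poly a k :
  (sym_trace_poly k).@[a] = \tr (sym_mx d (sl_point a) ^+ k).
Proof. by rewrite /sym_trace_poly -trace_map_mx map_mx_exp meval_sym_generic_mx. Qed.

Lemma sl_invariant_sym_trace_poly k : sl_invariant (sym_trace_poly k).
Proof.
move=> g g1 a b ab; have gU : g \in unitmx by rewrite unitmxE g1 unitr1.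
rewrite !meval_sym_trace_poly ab; have [S SU ->] := sym_mx_conj (sl_point a) gU.
by rewrite conj_mx_exp // mxtrace_mulC mulmxA mulVmx ?mul1mx.
Qed.

Lemma map_char_poly_sym (a : 'I_(N n) -> C) : map_poly (meval a) (char_poly_sym C n d)
  = \det ('X%:M + map_mx polyC (sym_mx d (sl_point a))).
Proof.
rewrite /char_poly_sym -det_map_mx; congr (\det _); apply/matrixP => i j.
rewrite -meval_sym_generic_mx !mxE rmorphD /= map_polyZ map_polyX map_polyC /=.
by rewrite rmorph_nat scaler_nat.
Qed.

Lemma sl_invariant_char_poly_sym i : sl_invariant (char_poly_sym C n d)`_i.
Proof.
move=> g g1 a b ab; have gU : g \in unitmx by rewrite unitmxE g1 unitr1.
rewrite -!coef_map !map_char_poly_sym ab; have [S SU ->] := sym_mx_conj (sl_point a) gU.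
congr (_`__); set M := sym_mx d _.
have SV : map_mx polyC S *m map_mx polyC (invmx S) = 1%:M :> 'M[{poly C}]_(sym_dim n d).
  by rewrite -map_mxM mulmxV // map_mx1.
have -> : 'X%:M + map_mx polyC (S *m M *m invmx S)
    = map_mx polyC S *m ('X%:M + map_mx polyC M) *m map_mx polyC (invmx S).
  by rewrite mulmxDr mulmxDl scalar_mxC -[_%:M *m _ *m _]mulmxA SV mulmx1 !map_mxM.
by rewrite !det_mulmx mulrAC -det_mulmx SV det1 mul1r.
Qed.

End Degree.
End SymmetricPower.

(** * Traces of powers on symmetric powers *)

Section SymmetricTraces.
Variables (C : numClosedFieldType) (n : nat).
Hypothesis n_gt0 : (0 < n)%N.

Definition weight (l : 'I_n -> C) (m : 'X_{1..n}) : C := \sum_i l i *+ m i.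

Section DiagonalValues.
Variables (d : nat) (l : 'rV[C]_n).
Hypothesis l0 : \sum_i l 0 i = 0.

Definition sym_weight (i : 'I_(sym_dim n d)) : C := weight (l 0) (sym_mnm i).

Lemma sym_trace_poly_diag k :
  (sym_trace_poly C n d k).@[coords (diag_mx l)] = psum sym_weight k.
Proof.
rewrite meval_sym_trace_poly sl_point_diag // sym_mx_diag diag_mx_exp mxtrace_diag.
by apply: eq_bigr => i _; rewrite !mxE.
Qed.

Lemma char_poly_sym_diag k : (k <= sym_dim n d)%N ->
  ((char_poly_sym C n d)`_(sym_dim n d - k)).@[coords (diag_mx l)] = esum sym_weight k.
Proof.
move=> kd; rewrite -coef_map map_char_poly_sym sl_point_diag // sym_mx_diag.
rewrite map_diag_mx -diag_const_mx -raddfD /= det_diag.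
rewrite (eq_bigr (fun i => 'X + (sym_weight i)%:P)) => [|i _]; last by rewrite !mxE.
by rewrite -(coef_prod_XDC sym_weight) card_ord.
Qed.

End DiagonalValues.

(** The case distinction matters: beyond [sym_dim n d] the truncated subtraction would return the
    constant coefficient instead of [0]. *)
Definition sym_coef d k : {mpoly C[N n]} :=
  if (k <= sym_dim n d)%N then (char_poly_sym C n d)`_(sym_dim n d - k) else 0.

Lemma sl_invariant_sym_coef d k : sl_invariant (sym_coef d k).
Proof.
rewrite /sym_coef; case: ifP => _; first exact: sl_invariant_char_poly_sym.
by move=> g _ a b _; rewrite !meval0.
Qed.

Lemma sym_coef_diag d k (l : 'rV[C]_n) : \sum_i l 0 i = 0 ->
  (sym_coef d k).@[coords (diag_mx l)] = esum (@sym_weight d l) k.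
Proof.
move=> l0; rewrite /sym_coef; case: leqP => kd; first exact: char_poly_sym_diag.
by rewrite meval0 esum_gt // card_ord.
Qed.

Lemma sym_coef0 d : sym_coef d 0 = 1.
Proof.
apply/eqP; rewrite -subr_eq0; apply/eqP/mpoly_vanish => a.
have [l l0 al] := sl_invariant_diag n_gt0 a.
rewrite mevalB meval1 al; last exact: sl_invariant_sym_coef.
by rewrite sym_coef_diag // esum0 subrr.
Qed.

(** At any point the invariants involved take their values at one diagonal matrix, where this is
    Newton's identity for the weights. *)
Lemma newton_sym d k : k.+1%:R * sym_coef d k.+1 =
  \sum_(j < k.+1) (-1) ^+ j * sym_trace_poly C n d j.+1 * sym_coef d (k - j)%N.
Proof.
apply/eqP; rewrite -subr_eq0; apply/eqP/mpoly_vanish => a.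
have [l l0 al] := sl_invariant_diag n_gt0 a.
rewrite mevalB mevalM rmorph_nat al; last exact: sl_invariant_sym_coef.
rewrite sym_coef_diag // newton (raddf_sum (meval _)) /=; apply/eqP; rewrite subr_eq0; apply/eqP.
apply: eq_bigr => j _; rewrite !mevalM rmorph_sign !al; first last.
- exact: sl_invariant_sym_trace_poly.
- exact: sl_invariant_sym_coef.
by rewrite sym_coef_diag // sym_trace_poly_diag.
Qed.

(** Multiplication by ['X_i ^+ r] maps the monomials of degree [d - r] bijectively onto those of
    degree [d] that it divides. *)
Lemma perm_sym_mnm_shift d (i : 'I_n) r : (r <= d)%N ->
  perm_eq [seq m : 'X_{1..n} <- codom (@sym_mnm n d) | (r <= m i)%N]
          [seq (m + U_(i) *+ r)%MM | m <- codom (@sym_mnm n (d - r))].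
Proof.
move=> rd; have uniq_codom e : uniq (codom (@sym_mnm n e)).
  by apply/injectiveP/sym_mnm_inj.
apply: uniq_perm.
- exact: filter_uniq.
- by rewrite map_inj_uniq //; apply: addIm.
move=> m; rewrite mem_filter mem_sym_mnm; apply/andP/mapP => [[rm /eqP md]|[m']].
  have Um : (U_(i) *+ r <= m)%MM.
    apply/mnm_lepP => j; rewrite mulmnE mnm1E.
    by case: eqP => [<-|_]; rewrite ?mul1n ?mul0n.
  exists (m - U_(i) *+ r)%MM; last by rewrite submK.
  rewrite mem_sym_mnm -(eqn_add2r r) subnK // -{2}(mul1n r) -(mdeg1 i) -mdegMn -mdegD.
  by rewrite submK // md.
rewrite mem_sym_mnm => /eqP m'd ->; rewrite mdegD mdegMn mdeg1 mul1n m'd subnK //.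
by rewrite mnmDE mulmnE mnm1E eqxx mul1n leq_addl.
Qed.

(* Both sides count the triples [(m, i, r)] with [|m| = d] and [r < m i],
   weighted by [G m]. *)
Lemma sum_sym_mnm d (G : 'X_{1..n} -> C) :
  d%:R * \sum_(k < sym_dim n d) G (sym_mnm k) =
  \sum_(r < d) \sum_(k < sym_dim n (d - r.+1)) \sum_i G (sym_mnm k + U_(i) *+ r.+1)%MM.
Proof.
have sumE e (H : 'X_{1..n} -> C) :
    \sum_(k < sym_dim n e) H (sym_mnm k) = \sum_(m <- codom (@sym_mnm n e)) H m.
  by rewrite big_map enumT.
under [RHS]eq_bigr => r _ do rewrite exchange_big /=.
rewrite exchange_big /= mulr_sumr.
(* The degree of a monomial counts the pairs [(i, r)] with [r] below its [i]-th exponent. *)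
have degE (k : 'I_(sym_dim n d)) : d%:R = \sum_i \sum_(r < d) (r.+1 <= sym_mnm k i)%:R :> C.
  rewrite -{1}(mdeg_sym_mnm k) mdegE natr_sum; apply: eq_bigr => i _.
  rewrite -natr_sum; congr _%:R.
  have le_d : (sym_mnm k i <= d)%N.
    by rewrite -{2}(mdeg_sym_mnm k) mdegE (bigD1 i) //= leq_addr.
  rewrite -[LHS](card_ord (sym_mnm k i)) -sum1_card (big_ord_widen _ (fun=> 1%N) le_d).
  by rewrite big_mkcond; apply: eq_bigr => r _; case: ifP.
under [LHS]eq_bigr => k _ do rewrite (degE k) mulr_suml.
rewrite [LHS]exchange_big; apply: eq_bigr => i _ /=.
under [LHS]eq_bigr => k _ do rewrite mulr_suml.
rewrite [LHS]exchange_big; apply: eq_bigr => r _ /=.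
rewrite (sumE d (fun m => (r < m i)%:R * G m)).
rewrite (sumE (d - r.+1)%N (fun m => G (m + U_(i) *+ r.+1)%MM)).
rewrite -[RHS](big_map (fun m => m + U_(i) *+ r.+1)%MM xpredT G).
rewrite -(perm_big _ (perm_sym_mnm_shift i (ltn_ord r))) big_filter [RHS]big_mkcond.
by apply: eq_bigr => m _; case: ifP => _; rewrite ?mul1r ?mul0r.
Qed.

(** Apply [sum_sym_mnm] to the [k]-th power of the weight: shifting a monomial by [r.+1] copies of
    [i] adds [r.+1] times [l_i] to its weight, and the binomial theorem expands the power. *)
Lemma psum_sym_weight d k (l : 'rV[C]_n) : d%:R * psum (@sym_weight d l) k =
  \sum_(r < d) \sum_(j < k.+1)
    ('C(k, j) * r.+1 ^ j)%:R * psum (l 0) j * psum (@sym_weight (d - r.+1) l) (k - j).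
Proof.
rewrite (sum_sym_mnm d (fun m => weight (l 0) m ^+ k)); apply: eq_bigr => r _.
transitivity (\sum_(q < sym_dim n (d - r.+1)) \sum_i \sum_(j < k.+1)
    ('C(k, j) * r.+1 ^ j)%:R * (l 0 i ^+ j * sym_weight l q ^+ (k - j))).
  apply: eq_bigr => q _; apply: eq_bigr => i _.
  have -> : weight (l 0) (sym_mnm q + U_(i) *+ r.+1)%MM = sym_weight l q + l 0 i *+ r.+1.
    rewrite /weight /sym_weight; under eq_bigr => j _ do rewrite mnmDE mulrnDr.
    rewrite big_split; congr (_ + _); rewrite (bigD1 i) //= big1 => [|j ji].
      by rewrite mulmnE mnm1E eqxx mul1n addr0.
    by rewrite mulmnE mnm1E eq_sym (negbTE ji).
  rewrite exprDn; apply: eq_bigr => j _.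
  by rewrite exprMn_n mulrnAr -mulrnA mulr_natl mulnC mulrC.
under eq_bigr => q _ do rewrite exchange_big.
rewrite exchange_big; apply: eq_bigr => j _ /=.
rewrite -mulrA mulr_suml mulr_sumr exchange_big; apply: eq_bigr => i _ /=.
by rewrite !mulr_sumr.
Qed.

Lemma sym_trace_recursion d k : d%:R * sym_trace_poly C n d k =
  \sum_(r < d) \sum_(j < k.+1) ('C(k, j) * r.+1 ^ j)%:R * trace_poly C n j
    * sym_trace_poly C n (d - r.+1) (k - j).
Proof.
apply/eqP; rewrite -subr_eq0; apply/eqP/mpoly_vanish => a.
have [l l0 al] := sl_invariant_diag n_gt0 a.
rewrite mevalB mevalM rmorph_nat al; last exact: sl_invariant_sym_trace_poly.
rewrite sym_trace_poly_diag // psum_sym_weight (raddf_sum (meval _)) /=.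
apply/eqP; rewrite subr_eq0; apply/eqP; apply: eq_bigr => r _; rewrite (raddf_sum (meval _)) /=.
apply: eq_bigr => j _; rewrite !mevalM rmorph_nat !al; first last.
- exact: sl_invariant_trace_poly.
- exact: sl_invariant_sym_trace_poly.
by rewrite trace_poly_diag // sym_trace_poly_diag.
Qed.

(** * The coefficient of [trace_poly C n k] in the traces on symmetric powers *)

Lemma sym_trace_poly_exp0 d : sym_trace_poly C n d 0 = (sym_dim n d)%:R.
Proof. by rewrite /sym_trace_poly expr0 mxtrace1. Qed.

Lemma sym_trace_poly_deg0 k : sym_trace_poly C n 0 k.+1 = 0.
Proof.
apply: mpoly_vanish => a; have [l l0 ->] := sl_invariant_diag n_gt0 a; last first.
  exact: sl_invariant_sym_trace_poly.
rewrite sym_trace_poly_diag // /psum big1 // => q _.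
have /eqP := mdeg_sym_mnm q; rewrite mdeg_eq0 => /eqP q0.
by rewrite /sym_weight /weight q0 big1 ?expr0n // => i _; rewrite mnm0E mulr0n.
Qed.

Lemma sym_dim0_gt0 : (0 < sym_dim n 0)%N.
Proof.
have : 0%MM \in codom (@sym_mnm n 0) by rewrite mem_sym_mnm mdeg0.
by case/codomP => i _; apply: leq_ltn_trans (ltn_ord i).
Qed.

(** Tracks the coefficient of the [k]-th trace modulo the algebra generated by [s]; nonnegativity
    survives the sums of the recursion, where cancellation must be excluded. *)
Definition nonneg_trace_mod s k (f : {mpoly C[N n]}) :=
  exists2 c : C, 0 <= c & in_gen_alg s (f - c *: trace_poly C n k).

Lemma nonneg_trace_modD s k f h :
  nonneg_trace_mod s k f -> nonneg_trace_mod s k h -> nonneg_trace_mod s k (f + h).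
Proof.
move=> [c c0 fc] [e e0 he]; exists (c + e); first exact: addr_ge0.
by rewrite scalerDl opprD addrACA; apply: gen_algD.
Qed.

Lemma nonneg_trace_modZ s k a f :
  nonneg_trace_mod s k f -> nonneg_trace_mod s k (a%:R * f).
Proof.
move=> [c c0 fc]; exists (a%:R * c); first by rewrite mulr_ge0 ?ler0n.
rewrite -scalerA -(mul_mpolyC a%:R) mpolyC_nat -mulrBr.
by apply/gen_algM/fc/gen_alg_nat.
Qed.

Lemma nonneg_trace_mod_gen s k f : in_gen_alg s f -> nonneg_trace_mod s k f.
Proof. by exists 0; rewrite // scale0r subr0. Qed.

Lemma nonneg_trace_mod_sum s k I (r : seq I) (F : I -> {mpoly C[N n]}) :
  (forall i, nonneg_trace_mod s k (F i)) -> nonneg_trace_mod s k (\sum_(i <- r) F i).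
Proof.
move=> sF; apply: big_ind => // [|f h]; last exact: nonneg_trace_modD.
exact/nonneg_trace_mod_gen/gen_alg0.
Qed.

Lemma trace_poly0 : trace_poly C n 0 = n%:R.
Proof. by rewrite /trace_poly expr0 mxtrace1. Qed.

(** The last term of the recursion: the zero action on S^0 kills every [j < k], and the term [j = k]
    supplies the strictly positive coefficient. *)
Lemma sym_trace_deg0_term d k :
  \sum_(j < k.+1) ('C(k, j) * d.+1 ^ j)%:R * trace_poly C n j
    * sym_trace_poly C n (d.+1 - d.+1) (k - j)
  = (d.+1 ^ k * sym_dim n 0)%:R *: trace_poly C n k.
Proof.
rewrite subnn big_ord_recr /= big1 => [|j _]; last first.
  by rewrite -[(k - j)%N]prednK ?subn_gt0 // sym_trace_poly_deg0 mulr0.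
rewrite add0r subnn binn mul1n sym_trace_poly_exp0 mulrAC -natrM -mpolyC_nat.
by rewrite mul_mpolyC.
Qed.

(** Induction on [k], then on [d]: all terms of the recursion contribute nonnegatively, and the one
    reaching S^0 strictly positively. *)
Lemma sym_trace_pos s k : (0 < k)%N ->
  (forall j, (0 < j < k)%N -> in_gen_alg s (trace_poly C n j)) ->
  forall d, exists2 c : C, 0 < c &
    in_gen_alg s (sym_trace_poly C n d.+1 k - c *: trace_poly C n k).
Proof.
elim/ltn_ind: k => k IHk k0 str; elim/ltn_ind => d IHd.
(* Lower power traces of every symmetric power already lie in the algebra, by induction on [k]. *)
have sT j e : (j < k)%N -> in_gen_alg s (sym_trace_poly C n e j).
  case: j e => [e _|j [|e] jk].
  - by rewrite sym_trace_poly_exp0; apply: gen_alg_nat.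
  - by rewrite sym_trace_poly_deg0; apply: gen_alg0.
  have [//|i /andP[i0 ij]|c _ sc] := IHk j.+1 jk _ _ e.
    by apply: str; rewrite i0 (ltn_trans ij).
  rewrite -[sym_trace_poly _ _ _ _](subrK (c *: trace_poly C n j.+1)).
  by apply/(gen_algD sc)/gen_algZ/str.
have T_nonneg e : (e <= d)%N -> nonneg_trace_mod s k (sym_trace_poly C n e k).
  case: e => [_|e /IHd[c /ltW c0 sc]]; last by exists c.
  by rewrite -(prednK k0) sym_trace_poly_deg0; apply/nonneg_trace_mod_gen/gen_alg0.
have [c c0] : nonneg_trace_mod s k (\sum_(r < d) \sum_(j < k.+1)
    ('C(k, j) * r.+1 ^ j)%:R * trace_poly C n j * sym_trace_poly C n (d.+1 - r.+1) (k - j)).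
  apply: nonneg_trace_mod_sum => r; apply: nonneg_trace_mod_sum => j.
  rewrite -mulrA; apply: nonneg_trace_modZ.
  (* For [j = 0] the factor is [n] times a [k]-th trace in smaller degree; for [0 < j < k] both
     factors lie in the algebra; for [j = k] a dimension multiplies the [k]-th trace itself. *)
  have [j0|j0] := posnP j.
    by rewrite j0 trace_poly0 subn0 subSS; apply/nonneg_trace_modZ/T_nonneg/leq_subr.
  have [jk|] := ltnP j k.
    apply/nonneg_trace_mod_gen/gen_algM; first by apply: str; rewrite j0.
    by apply: sT; rewrite -subn_gt0 subKn ?(ltnW jk).
  move=> kj; have -> : nat_of_ord j = k by apply/eqP; rewrite eqn_leq kj -ltnS ltn_ord.
  rewrite subnn sym_trace_poly_exp0 mulrC; apply: nonneg_trace_modZ.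
  by exists 1 => //; rewrite scale1r subrr; apply: gen_alg0.
set S := (X in X - _) => sc.
pose b : C := (d.+1 ^ k * sym_dim n 0)%:R.
have b0 : 0 < b by rewrite ltr0n muln_gt0 expn_gt0 sym_dim0_gt0.
exists (d.+1%:R^-1 * (c + b)); first by rewrite mulr_gt0 ?invr_gt0 ?ltr0n ?ltr_wpDl.
have -> : sym_trace_poly C n d.+1 k = d.+1%:R^-1 *: (d.+1%:R * sym_trace_poly C n d.+1 k).
  by rewrite -mpolyC_nat mul_mpolyC scalerA mulVf ?pnatr_eq0 // scale1r.
rewrite -scalerA -scalerBr; apply: gen_algZ.
rewrite sym_trace_recursion big_ord_recr /= sym_trace_deg0_term -/b scalerDl.
by rewrite [c *: _ + _]addrC addrKA.
Qed.

Lemma gen_alg_char_coeffs_sym_coef d k : in_gen_alg (char_coeffs C n d) (sym_coef d k).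
Proof.
case: k => [|k]; first by rewrite sym_coef0; apply: gen_alg1.
rewrite /sym_coef; case: leqP => [_|kd]; first exact: gen_alg0.
by apply/gen_alg_mem/map_f; rewrite mem_iota.
Qed.

(** Newton's identities recover the power sums of the weights from the coefficients; as [c] is
    nonzero, [sym_trace_pos] can then be solved for the [k]-th trace. *)
Lemma gen_alg_char_coeffs_trace_poly d k : (0 < d)%N -> (0 < k)%N ->
  in_gen_alg (char_coeffs C n d) (trace_poly C n k).
Proof.
move=> d0; elim/ltn_ind: k => k IH k0.
have sT : in_gen_alg (char_coeffs C n d) (sym_trace_poly C n d k).
  rewrite -(prednK k0); apply: gen_alg_psum (newton_sym d) _ _.
    exact: sym_coef0.
  exact: gen_alg_char_coeffs_sym_coef.
have [j /andP[j0 jk]|c c0] := @sym_trace_pos (char_coeffs C n d) k k0 _ d.-1.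
  exact: IH.
rewrite prednK // => sc.
have -> : trace_poly C n k = c^-1 *: (sym_trace_poly C n d k
    - (sym_trace_poly C n d k - c *: trace_poly C n k)).
  by rewrite subKr scalerA mulVf ?gt_eqF // scale1r.
exact/gen_algZ/gen_algB.
Qed.

End SymmetricTraces.

Theorem theorem1p3 (C : numClosedFieldType) (n d : nat) :
  (2 <= n)%N -> (1 <= d)%N ->
  [/\ (forall f, in_gen_alg (char_coeffs C n d) f <-> in_gen_alg (traces C n) f),
      alg_indep (traces C n)
    & (forall f, in_gen_alg (traces C n) f <-> sl_invariant f)].
Proof.
move=> /ltnW n0 d0; split=> [f||f].
- split; apply: gen_alg_trans => h /mapP[k].
    (* The coefficients reach the trace algebra through their invariance, without an explicit
       formula. *)
    by move=> _ ->; apply/(sl_invariant_in_traces n0)/sl_invariant_char_poly_sym.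
  rewrite mem_iota => /andP[k2 _] ->.
  by apply: gen_alg_char_coeffs_trace_poly => //; apply: ltnW.
- exact: alg_indep_traces.
by split; [exact: sl_invariant_traces | exact: sl_invariant_in_traces].
Qed.
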